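(* Let $\delta\in(0,1)$ and suppose that the observed Gaussian vector $\boldsymbol X=(X_1,\dots,X_n)^\top$ has covariance matrix $\Sigma_n=\mathcal{T}_n(f)=[f_{|r-s|}]_{r,s=1}^n$, where $f:[-\pi,\pi]\to\mathbb{R}$ is a real symmetric function with Fourier coefficients $\{f_m\}$ satisfying: (a) $0<m_f:=\inf_{\omega\in[-\pi,\pi]}f(\omega)\le M_f:=\sup_{\omega\in[-\pi,\pi]}f(\omega)<\infty$; (b) for some positive constants $c,\lambda$, $|f_k|\le c(1+k)^{-(1+\lambda)}$ for all integers $k\ge 0$. Consider the GLRT $T_{GLRT}$ (known covariance, threshold $R_{n,\delta}$) for the shift-in-mean problem described in the context. There exist $n_0\in\mathbb{N}$, $C>0$ (depending only on $c$ and $\lambda$) and $R_{n,\delta}>0$ such that for any $n\ge n_0$, if $$|b|\ge C\sqrt{f(0)\,n^{-1}\log\left(\frac{n(1-2\alpha)}{\delta}\right)},$$ then $\varphi_n(T_{GLRT})\le\delta$.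
   Context: Increasing domain setting: $\{X_k\}_{k\ge1}$ is a Gaussian sequence with $\mathrm{cov}(X_r,X_s)=f_{|r-s|}$, normalized so that $f_0=1$. Here $f_m=\frac1{2\pi}\int_{-\pi}^{\pi}f(\omega)e^{-jm\omega}d\omega$, and $f$ equals its (absolutely convergent) Fourier series, so $f(0)=\sum_{m\in\mathbb{Z}}f_m$. Testing problem: fix $\alpha\in(0,1/2)$ and let $\mathcal{C}_{n,\alpha}=\{t\in\{1,\dots,n\}: t\wedge(n-t)>\alpha n\}$. For $t\in\mathcal{C}_{n,\alpha}$ let $\zeta_t\in\mathbb{R}^n$ have $\zeta_t(k)=-1$ for $k\le t$ and $\zeta_t(k)=+1$ for $k>t$. The null hypothesis is $\mathbb{H}_0:\mathbb{E}\boldsymbol X=0$; the alternative with change point $t$ and jump $b\neq0$ is $\mathbb{H}_{1,t}:\mathbb{E}\boldsymbol X=\frac b2\zeta_t$ (same covariance). The GLRT with threshold $R_{n,\delta}$ is $$T_{GLRT}=\mathbb{1}\left(\max_{t\in\mathcal{C}_{n,\alpha}}\left|\frac{\zeta_t^\top\Sigma_n^{-1}\boldsymbol X}{\sqrt{\zeta_t^\top\Sigma_n^{-1}\zeta_t}}\right|^2\ge R_{n,\delta}\right).$$ For a test $T\in\{0,1\}$ (a function of $\boldsymbol X$), the conditional detection error probability is $\varphi_n(T)=\mathbb{P}(T=1\mid\mathbb{H}_0)+\max_{t\in\mathcal{C}_{n,\alpha}}\mathbb{P}(T=0\mid\mathbb{H}_{1,t})$, where under $\mathbb{H}_{1,t}$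 the jump size is $b$. *)

(* Defs.v *)
From HB Require Import structures.
From mathcomp Require Export all_boot all_order all_algebra.
From mathcomp Require Export all_classical all_reals all_analysis.
Export Order.TTheory GRing.Theory Num.Theory.
Export numFieldNormedType.Exports.

Set Implicit Arguments.
Unset Strict Implicit.
Unset Printing Implicit Defensive.

Local Open Scope classical_set_scope.
Local Open Scope ring_scope.

(* f_m = (1 / 2 pi) \int f(w) e^{-jmw} dw.  Every f considered is real and even
   on [-pi, pi], so the imaginary part - \int f(w) sin(mw) dw / (2 pi)
   vanishes, f_m is real and f_{-m} = f_m. *)
Definition fourier_coef (R : realType) (f : R -> R) (m : int) : R :=
  (2 * pi)^-1 *
  (\int[lebesgue_measure]_(w in `[(- pi)%R, pi%R]) (f w * cos (m%:~R * w))).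

(* \sum_(-N <= m <= N) f_m e^{jmw}; since f_{-m} = f_m, the imaginary parts
   cancel between m and -m. *)
Definition fourier_sum (R : realType) (f : R -> R) (N : nat) (w : R) : R :=
  fourier_coef f 0 +
  \sum_(1 <= m < N.+1) (fourier_coef f m%:Z * cos (m%:R * w) +
                        fourier_coef f (- m%:Z) * cos (- m%:R * w)).

Definition toeplitz (R : realType) (n : nat) (f : R -> R) : 'M[R]_n :=
  \matrix_(r < n, s < n) fourier_coef f `|r%:Z - s%:Z|.

Definition change_point (R : realType) (alpha : R) (n t : nat) : bool :=
  (1 <= t <= n)%N && (alpha * n%:R < (minn t (n - t))%:R).

(* The index i : 'I_n stands for the time k = i + 1, so i < t means k <= t. *)
Definition zeta (R : realType) (n t : nat) : 'cV[R]_n :=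
  \col_(i < n) (if (i < t)%N then -1 else 1).

(* The maximum has default value 0, which is harmless since the maximised
   quantity is nonnegative and change points exist for n large. *)
Definition glrt_stat (R : realType) (n : nat) (alpha : R) (Sigma : 'M[R]_n)
    (x : 'cV[R]_n) : R :=
  \big[Num.max/0]_(1 <= t < n.+1 | change_point alpha n t)
    `| ((zeta R n t)^T *m invmx Sigma *m x) 0 0 /
       Num.sqrt (((zeta R n t)^T *m invmx Sigma *m zeta R n t) 0 0) | ^+ 2.

Definition glrt (R : realType) (n : nat) (alpha : R) (Sigma : 'M[R]_n)
    (threshold : R) (x : 'cV[R]_n) : bool :=
  threshold <= glrt_stat alpha Sigma x.

(* [normal_prob m 0] is not the point mass at m but the uniform law on
   [0, 1]. *)
Definition normal_law (R : realType) (m s : R) (A : set R) : \bar R :=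
  if s == 0 then \d_m A else normal_prob m s A.

Definition sample (R : realType) (d : measure_display) (Omega : measurableType d)
    (n : nat) (X : 'I_n -> {mfun Omega >-> R}) (w : Omega) : 'cV[R]_n :=
  \col_i X i w.

Definition gaussian_vector (R : realType) (d : measure_display)
    (Omega : measurableType d) (P : probability Omega R) (n : nat)
    (X : 'I_n -> {mfun Omega >-> R}) : Prop :=
  forall a : 'I_n -> R, exists m s : R, forall A : set R, measurable A ->
    P [set w | A (\sum_(i < n) a i * X i w)] = normal_law m s A.

Definition gaussian_with (R : realType) (d : measure_display)
    (Omega : measurableType d) (P : probability Omega R) (n : nat)
    (X : 'I_n -> {mfun Omega >-> R}) (mu : 'cV[R]_n) (Sigma : 'M[R]_n) : Prop :=
  [/\ gaussian_vector P X,
      forall i, ('E_P[X i] = (mu i 0)%:E)%E &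
      forall i j, covariance P (X i) (X j) = (Sigma i j)%:E].

(* Conditional probability given a hypothesis is the probability under the
   corresponding member of the statistical model: P0 is the law under H_0 and
   P1 t the law under H_{1,t}. *)
Definition detection_error (R : realType) (d : measure_display)
    (Omega : measurableType d) (n : nat) (alpha : R)
    (X : 'I_n -> {mfun Omega >-> R})
    (P0 : probability Omega R) (P1 : nat -> probability Omega R)
    (T : 'cV[R]_n -> bool) : \bar R :=
  (P0 [set w | T (sample X w)] +
   \big[maxe/0]_(1 <= t < n.+1 | change_point alpha n t)
     P1 t [set w | ~~ T (sample X w)])%E.

(* Main.v *)
Require Import Defs.
From mathcomp Require Import measurable_realfun zify ring lra.

(** Write [q_t] for the form of the inverse covariance matrix at [zeta_t]. The
statistic at a change point [t] is the square of a linear functional of the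
sample with variance 1; its mean is 0 under the null hypothesis and
[b / 2 * sqrt q_t] under the alternative with change point [t]. A functional
of variance 1 leaves the interval of radius [r] around its mean with
probability at most [2 * exp (- r ^ 2 / 128)] ([gaussian_tail]). With
threshold [r ^ 2], a union bound over the at most [n (1 - 2 alpha) + 1] change
points controls the false alarms, and a change point is missed with no larger
probability than one such tail as soon as the mean is at least [2 r], that is
[16 r ^ 2 <= b ^ 2 q_t] ([detection_error_le]). Taking [r ^ 2] of the order of
[ln (n (1 - 2 alpha) / delta)] brings the error below [delta]
([error_budget_le]), and the assumption on [b] gives a large enough mean once
[q_t] is bounded below by a constant times [n / f 0].

This lower bound is where the spectral density enters. By the Cauchy-Schwarz
inequality, [q_t] is at least [n ^ 2] divided by the form of the Toeplitz matrix
at [zeta_t] ([inverse_form_ge]). Since [zeta_t] is the difference of the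
indicators of the two segments cut at [t], whose sum is the constant vector, the
parallelogram identity and the positivity of the form bound it by twice the sum
of the forms of the two indicators ([toeplitz_zeta_le]). The form of the
indicator of a segment of length [k] is the sum of all entries of a [k] by [k]
Toeplitz matrix, which is also the sum of the first [k] Fourier partial sums
of [f] at 0 ([toeplitz_sum_cesaro]). By Cesaro's theorem it is equivalent to
[k * f 0], hence at most [2 k f 0] for large [k], and both segments are long
because they have more than [alpha n] elements. Altogether
[q_t >= n / (4 f 0)]. Cesaro's theorem gives no rate, so the rank from which this
holds depends on [f]; this is harmless, as [n0] is chosen after [f].

Gaussian vectors are characterized by linear functionals having normal laws with
some parameters. Instead of computing the moments of a normal law, these
parameters are located up to absolute constants from the second moment of the
functional ([normal_law_parameters]); the loss is absorbed in the constant
[C]. *)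

Set Implicit Arguments.
Unset Strict Implicit.
Unset Printing Implicit Defensive.

Local Open Scope classical_set_scope.
Local Open Scope ring_scope.

(** * Normal laws up to constants *)

Lemma measurable_dist_ge (R : realType) (m r : R) :
  measurable [set y : R | r <= `|y - m|].
Proof.
rewrite -[X in measurable X]setTI.
apply: (@measurable_fun_le _ _ _ setT (cst r) (fun y : R => `|y - m|)) => //.
by apply: measurableT_comp => //; exact: measurable_funB.
Qed.

(** On the event, half of the exponent is at least [r ^ 2 / (4 s ^ 2)]; the other
half is, up to the factor [sqrt 2], the density of the normal law of standard
deviation [sqrt 2 * s], whose total mass is 1. *)
Lemma normal_prob_tail (R : realType) (m s r : R) : s != 0 -> 0 <= r ->
  (normal_prob m s [set y | (r <= `|y - m|)%R] <=
   (2 * expR (- (r ^+ 2 / (4 * s ^+ 2))))%:E)%E.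
Proof.
move=> s0 r0.
have s2 : 0 < s ^+ 2 by rewrite exprn_even_gt0.
(* The comparison density: doubling the variance halves the exponent. *)
pose s' := Num.sqrt 2 * s.
have s'0 : s' != 0 by rewrite mulf_neq0// gt_eqF// sqrtr_gt0.
have s'2 : s' ^+ 2 = 2 * s ^+ 2 by rewrite exprMn sqr_sqrtr.
have := measurable_dist_ge m r; set A := [set y | _] => mA.
set K : R := 2 * _.
have K0 : 0 <= K by rewrite mulr_ge0 ?expR_ge0.
have mpdf (u : R) (D : set R) : measurable_fun D (fun x => (normal_pdf m u x)%:E).
  by apply/measurable_EFinP/measurable_funTS; exact: measurable_normal_pdf.
apply: (@le_trans _ _ (\int[lebesgue_measure]_(y in A)
    (K%:E * (normal_pdf m s' y)%:E))%E).
  apply: ge0_le_integral => //=.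
  - by move=> y _; rewrite lee_fin normal_pdf_ge0.
  - exact: mpdf.
  - by apply: measurable_funeM; exact: mpdf.
  - move=> y ry; rewrite -EFinM lee_fin !normal_pdfE// /normal_peak /normal_fun s'2.
    have -> : Num.sqrt (2 * s ^+ 2 * pi *+ 2) =
              Num.sqrt 2 * Num.sqrt (s ^+ 2 * pi *+ 2).
      by rewrite -sqrtrM//; congr Num.sqrt; ring.
    set p := Num.sqrt (s ^+ 2 * pi *+ 2).
    have p0 : 0 < p by rewrite sqrtr_gt0 pmulrn_lgt0// mulr_gt0// pi_gt0.
    have q0 : 0 < Num.sqrt 2 :> R by rewrite sqrtr_gt0.
    have -> : K * ((Num.sqrt 2 * p)^-1 *
                  expR (- (y - m) ^+ 2 / (2 * s ^+ 2 *+ 2))) =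
        p^-1 * (Num.sqrt 2 * (expR (- (r ^+ 2 / (4 * s ^+ 2))) *
                expR (- (y - m) ^+ 2 / (2 * s ^+ 2 *+ 2)))).
      have e2 : 2 = Num.sqrt 2 * Num.sqrt 2 :> R by rewrite -expr2 sqr_sqrtr.
      by rewrite /K {1}e2; field; rewrite !gt_eqF.
    rewrite ler_pM2l ?invr_gt0//.
    have q1 : 1 <= Num.sqrt 2 :> R by rewrite -[leLHS]sqrtr1 ler_sqrt ?ler1n.
    rewrite -expRD; apply: le_trans (ler_wpM2r (expR_ge0 _) q1).
    rewrite mul1r ler_expR.
    have ry2 : r ^+ 2 <= (y - m) ^+ 2.
      by rewrite -(@real_normK _ (y - m)) ?num_real// lerXn2r ?nnegrE ?normr_ge0.
    have -> : - (y - m) ^+ 2 / (s ^+ 2 *+ 2) =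
      - ((y - m) ^+ 2 / (4 * s ^+ 2)) + - (y - m) ^+ 2 / (2 * s ^+ 2 *+ 2).
      by field.
    by rewrite lerD2r lerN2 ler_pM2r// invr_gt0 mulr_gt0.
rewrite ge0_integralZl//=; last 2 first.
- exact: mpdf.
- by move=> y _; rewrite lee_fin normal_pdf_ge0.
rewrite -[leRHS]mule1 lee_wpmul2l//.
exact: (@probability_le1 _ _ _ (normal_prob m s')).
Qed.

(** The density is at most [1 / (sqrt (2 pi) * |s|)] and [sqrt (2 pi) >= 2]. *)
Lemma normal_prob_ball (R : realType) (m s a : R) : s != 0 ->
  (normal_prob m s [set y | (`|y - a| < `|s| / 2)%R] <= (2^-1)%:E)%E.
Proof.
move=> s0.
have as0 : 0 < `|s| by rewrite normr_gt0.
have -> : [set y | `|y - a| < `|s| / 2] = `]a - `|s| / 2, a + `|s| / 2[%classic.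
  by apply/seteqP; split=> y /=; rewrite in_itv/= ltr_distl.
set A := [set` _]; have mA : measurable A by exact: measurable_itv.
apply: (@le_trans _ _ (\int[lebesgue_measure]_(y in A)
    (normal_peak s)%:E)%E).
  apply: ge0_le_integral => //=.
  - by move=> y _; rewrite lee_fin normal_pdf_ge0.
  - by apply/measurable_EFinP/measurable_funTS; exact: measurable_normal_pdf.
  - by move=> y _; rewrite lee_fin normal_pdf_ub.
rewrite integral_cst//= /A lebesgue_measure_itv/= lte_fin.
rewrite ltrD2l gtrN ?divr_gt0// -EFinB -EFinM lee_fin.
have -> : a + `|s| / 2 - (a - `|s| / 2) = `|s| by field.
rewrite /normal_peak -mulrnAr sqrtrM ?sqr_ge0// sqrtr_sqr.
rewrite invfM mulrAC mulVf ?gt_eqF// mul1r lef_pV2 ?posrE//; last first.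
  by rewrite sqrtr_gt0 mulrn_wgt0// pi_gt0.
have sqrt_ge2 (p : R) : 2 <= p -> 2 <= Num.sqrt (p *+ 2).
  move=> p2; have {1}-> : 2 = Num.sqrt (2 ^+ 2) :> R by rewrite sqrtr_sqr ger0_norm.
  by rewrite ler_sqrt; lra.
by apply: sqrt_ge2; exact: pi_ge2.
Qed.

(** * Linear statistics of a Gaussian vector *)

(** A finite variance makes the centered squares integrable, and products are
dominated by [|x y| <= x ^ 2 + y ^ 2]. *)
Lemma integrable_cross (R : realType) (d : measure_display)
    (Omega : measurableType d) (P : probability Omega R) (n : nat)
    (X : 'I_n -> {mfun Omega >-> R}) (mu : 'cV[R]_n) (Sigma : 'M[R]_n) :
  gaussian_with P X mu Sigma -> forall i j,
  P.-integrable setT (fun w => ((X i w - mu i 0) * (X j w - mu j 0))%:E) /\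
  (\int[P]_w ((X i w - mu i 0) * (X j w - mu j 0))%:E = (Sigma i j)%:E)%E.
Proof.
move=> [_ Emu cov].
have mY i : measurable_fun setT (fun w => X i w - mu i 0).
  exact: measurable_funB.
have mYY i j : measurable_fun setT (fun w => (X i w - mu i 0) * (X j w - mu j 0)).
  exact: measurable_funM.
have intYY i j :
    (\int[P]_w ((X i w - mu i 0) * (X j w - mu j 0))%:E = (Sigma i j)%:E)%E.
  by rewrite -cov unlock !Emu unlock.
have sq i : P.-integrable setT (fun w => ((X i w - mu i 0) * (X i w - mu i 0))%:E).
  apply/integrableP; split; first exact/measurable_EFinP.
  under eq_integral => w _ do rewrite gee0_abs ?lee_fin -?expr2 ?sqr_ge0//.
  by under eq_integral => w _ do rewrite expr2; rewrite intYY ltry.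
move=> i j; split; last exact: intYY.
apply: (le_integrable _ _ _ (integrableD _ (sq i) (sq j))) => //.
  exact/measurable_EFinP.
move=> w _; rewrite -EFinD !abse_EFin lee_fin.
set x := X i w - _; set y := X j w - _.
have xy0 : 0 <= x * x + y * y by nra.
by rewrite (ger0_norm xy0) ler_norml; apply/andP; split; nra.
Qed.

(** Centering at the vector [mu], instead of at the expectation of the functional,
reduces the variance of a linear functional to the covariances alone. *)
Lemma second_moment (R : realType) (d : measure_display)
    (Omega : measurableType d) (P : probability Omega R) (n : nat)
    (X : 'I_n -> {mfun Omega >-> R}) (mu : 'cV[R]_n) (Sigma : 'M[R]_n)
    (a : 'rV[R]_n) :
  gaussian_with P X mu Sigma ->
  (\int[P]_w (((a *m sample X w) 0 0 - (a *m mu) 0 0) ^+ 2)%:E =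
   ((a *m Sigma *m a^T) 0 0)%:E)%E.
Proof.
move=> /integrable_cross XX.
under eq_integral => w _.
  have -> : ((a *m sample X w) 0 0 - (a *m mu) 0 0) ^+ 2 =
      \sum_i \sum_j a 0 i * a 0 j * ((X i w - mu i 0) * (X j w - mu j 0)).
    rewrite !mxE -sumrB expr2 mulr_suml; apply: eq_bigr => i _.
    rewrite mulr_sumr; apply: eq_bigr => j _; rewrite !mxE; ring.
  rewrite -sumEFin; under eq_bigr => i _ do rewrite -sumEFin.
  over.
have iXX i j : P.-integrable setT (fun w =>
    (a 0 i * a 0 j * ((X i w - mu i 0) * (X j w - mu j 0)))%:E).
  under eq_fun do rewrite EFinM.
  by apply: integrableZl => //; exact: (XX i j).1.
rewrite integral_sum//=; last by move=> i; exact: integrable_sum.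
under eq_bigr => i _.
  rewrite integral_sum//=.
  under eq_bigr => j _.
    under eq_integral do rewrite EFinM.
    rewrite integralZl//= ?(XX i j).2 -?EFinM; last exact: (XX i j).1.
    over.
  rewrite sumEFin; over.
rewrite sumEFin mxE; under [in RHS]eq_bigr => j _ do rewrite !mxE mulr_suml.
rewrite exchange_big; congr EFin; apply: eq_bigr => i _; apply: eq_bigr => j _.
by ring.
Qed.

Lemma measurable_comp_dist_ge (R : realType) (d : measure_display)
    (Omega : measurableType d) (Y : Omega -> R) (m r : R) :
  measurable_fun setT Y -> measurable [set w | r <= `|Y w - m|].
Proof.
move=> mY; rewrite -[X in measurable X]setTI.
exact: (mY measurableT _ (measurable_dist_ge m r)).
Qed.

Lemma chebyshev_about (R : realType) (d : measure_display)
    (Omega : measurableType d) (P : probability Omega R) (Y : Omega -> R)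
    (e r : R) : measurable_fun setT Y -> 0 < r ->
  (\int[P]_w ((Y w - e) ^+ 2)%:E = 1)%E ->
  (P [set w | (r <= `|Y w - e|)%R] <= (r ^- 2)%:E)%E.
Proof.
move=> mY r0 int1.
have mYe : measurable_fun setT (fun w => Y w - e) by exact: measurable_funB.
have mA := measurable_comp_dist_ge e r mY.
rewrite -[leRHS]mule1 -lee_pdivrMl ?invr_gt0 ?exprn_gt0// invrK -int1.
rewrite -[P _]mul1e -integral_cst// -ge0_integralZl//=; last first.
  by rewrite lee_fin sqr_ge0.
apply: (@le_trans _ _
    (\int[P]_(w in [set w | (r <= `|Y w - e|)%R]) ((Y w - e) ^+ 2)%:E)%E).
  apply: ge0_le_integral => //=.
  - by move=> w _; rewrite mule1 lee_fin sqr_ge0.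
  - apply/measurable_EFinP/measurable_funTS; exact: measurable_funX.
  - move=> w rw; rewrite mule1 lee_fin -(@real_normK _ (Y w - e)) ?num_real//.
    by rewrite lerXn2r ?nnegrE ?normr_ge0// ltW.
apply: ge0_subset_integral => //=.
- by apply/measurable_EFinP; exact: measurable_funX.
- by move=> w _; rewrite lee_fin sqr_ge0.
Qed.

(** A normal law with large [s] spreads too much to have second moment 1 about any
point: it gives mass at most 1/2 to a ball of radius [|s| / 2], while Chebyshev's
inequality leaves mass at most [4 / s ^ 2] outside. Then the law concentrates both
around [m] and around [e], so that these two points are close. *)
Lemma normal_law_parameters (R : realType) (d : measure_display)
    (Omega : measurableType d) (P : probability Omega R) (Y : Omega -> R)
    (m s e : R) : measurable_fun setT Y -> s != 0 ->
  (forall A, measurable A -> P [set w | A (Y w)] = normal_prob m s A) ->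
  (\int[P]_w ((Y w - e) ^+ 2)%:E = 1)%E ->
  s ^+ 2 <= 8 /\ `|m - e| <= 14.
Proof.
move=> mY s0 law int1.
have as0 : 0 < `|s| by rewrite normr_gt0.
have ss : `|s| * `|s| = s ^+ 2 by rewrite -expr2 real_normK ?num_real.
have s8 : s ^+ 2 <= 8.
  have Pge := chebyshev_about mY (divr_gt0 as0 (ltr0Sn R 1)) int1.
  have Plt : (P [set w | (`|Y w - e| < `|s| / 2)%R] <= (2^-1)%:E)%E.
    rewrite (law [set y | `|y - e| < `|s| / 2]); first exact: normal_prob_ball.
    rewrite (_ : [set y | _] = ~` [set y | `|s| / 2 <= `|y - e|]).
      by apply: measurableC; exact: measurable_dist_ge.
    by apply/seteqP; split=> y /=; rewrite ltNge => /negP.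
  (* The ball and its complement carry the whole mass. *)
  have cov : (1 <= P ([set w | (`|s| / 2 <= `|Y w - e|)%R] `|`
                      [set w | (`|Y w - e| < `|s| / 2)%R]))%E.
    rewrite (_ : _ `|` _ = setT) ?probability_setT//.
    by apply/seteqP; split=> w //= _; case: (leP (`|s| / 2)); [left|right].
  have mlt : measurable [set w | `|Y w - e| < `|s| / 2].
    rewrite (_ : [set w | _] = ~` [set w | `|s| / 2 <= `|Y w - e|]).
      by apply: measurableC; exact: measurable_comp_dist_ge.
    by apply/seteqP; split=> y /=; rewrite ltNge => /negP.
  have := le_trans cov (le_trans
    (measureU2 P (measurable_comp_dist_ge _ _ mY) mlt) (leeD Pge Plt)).
  rewrite -EFinD lee_fin exprMn real_normK ?num_real// => h.
  have s2 : 0 < s ^+ 2 by rewrite exprn_even_gt0.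
  have : 2^-1 <= (s ^+ 2 / 4)^-1.
    have -> : s ^+ 2 / 4 = s ^+ 2 * 2^-1 ^+ 2 by field.
    lra.
  by rewrite lef_pV2 ?posrE ?divr_gt0// => s4; lra.
split => //.
have s3 : `|s| <= 3 by nra.
have far_e := chebyshev_about mY (ltr0Sn R 1) int1.
have far_m : (P [set w | (4 * `|s| <= `|Y w - m|)%R] < (2^-1)%:E)%E.
  rewrite (law [set y | 4 * `|s| <= `|y - m|]); last exact: measurable_dist_ge.
  apply: le_lt_trans (normal_prob_tail _ s0 _) _; first by rewrite mulr_ge0.
  rewrite lte_fin exprMn real_normK ?num_real//.
  have -> : 4 ^+ 2 * s ^+ 2 / (4 * s ^+ 2) = 4 by field.
  have e4 : 5 <= expR 4 :> R by have := expR_ge1Dx (4 : R); lra.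
  have : (expR 4)^-1 <= 5^-1 :> R by rewrite lef_pV2 ?posrE ?expR_gt0.
  rewrite expRN; lra.
(* Two sets of mass at most 1/4 and less than 1/2 cannot cover everything. *)
have : [set w | 2 <= `|Y w - e|] `|` [set w | 4 * `|s| <= `|Y w - m|] <> setT.
  move=> all; have : (P setT <= P [set w | 2 <= `|Y w - e|]%R +
                                P [set w | 4 * `|s| <= `|Y w - m|]%R)%E.
    by rewrite -all; apply: measureU2; exact: measurable_comp_dist_ge.
  rewrite probability_setT leNgt => /negP; apply.
  apply: (@lt_le_trans _ _ ((2 ^- 2)%:E + (2^-1)%:E)%E); last first.
    by rewrite -EFinD lee_fin; lra.
  apply: (lee_ltD _ far_e far_m); apply: fin_num_measure.
  exact: measurable_comp_dist_ge.
have [//|none] := pselect (exists w, `|Y w - e| < 2 /\ `|Y w - m| < 4 * `|s|).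
  move=> [w [we wm]] _; have := ler_distD (Y w) m e.
  rewrite (distrC m (Y w)); lra.
case; apply/seteqP; split => w //= _.
have [we|we] := leP 2 (`|Y w - e|); [by left|right].
by rewrite leNgt; apply/negP => wm; apply: none; exists w.
Qed.

(** Recentering a deviation [r >= 28] from [e] to [m] costs at most [14 <= r / 2]. In
the degenerate case the law is a point mass, and Chebyshev's inequality forces this
point to be at distance less than [r] from [e]. *)
Lemma normal_law_tail (R : realType) (d : measure_display)
    (Omega : measurableType d) (P : probability Omega R) (Y : Omega -> R)
    (m s e r : R) : measurable_fun setT Y ->
  (forall A, measurable A -> P [set w | A (Y w)] = normal_law m s A) ->
  (\int[P]_w ((Y w - e) ^+ 2)%:E = 1)%E -> 28 <= r ->
  (P [set w | (r <= `|Y w - e|)%R] <= (2 * expR (- (r ^+ 2 / 128)))%:E)%E.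
Proof.
move=> mY law int1 r28; have r0 : 0 < r by lra.
have [s0|s0] := eqVneq s 0.
  have := chebyshev_about mY r0 int1.
  rewrite !(law [set y | r <= `|y - e|]); last exact: measurable_dist_ge.
  rewrite /normal_law s0 eqxx diracE.
  case: (_ \in _) => /=; rewrite !lee_fin.
    rewrite -[leRHS]div1r ler_pdivlMr ?exprn_gt0//; nra.
  by rewrite mulr_ge0 ?expR_ge0.
have {}law A : measurable A -> P [set w | A (Y w)] = normal_prob m s A.
  by move=> /law ->; rewrite /normal_law (negbTE s0).
have [s8 me] := normal_law_parameters mY s0 law int1.
apply: (@le_trans _ _ (P [set w | (r / 2 <= `|Y w - m|)%R])).
  apply: le_measure; rewrite ?inE.
  - exact: measurable_comp_dist_ge.
  - exact: measurable_comp_dist_ge.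
  - move=> w /= rw; have := ler_distD m (Y w) e; lra.
rewrite (law [set y | r / 2 <= `|y - m|]); last exact: measurable_dist_ge.
apply: le_trans (normal_prob_tail _ s0 _) _; first lra.
rewrite lee_fin ler_pM2l// ler_expR lerN2.
have s2 : 0 < s ^+ 2 by rewrite exprn_even_gt0.
have s4 : 0 < 4 * s ^+ 2 by lra.
rewrite ler_pdivlMr//.
have : 0 <= r ^+ 2 * (8 - s ^+ 2) by rewrite mulr_ge0 ?sqr_ge0 ?subr_ge0.
have -> : (r / 2) ^+ 2 = r ^+ 2 / 4 by field.
lra.
Qed.

Lemma projection_sum (R : realType) (d : measure_display)
    (Omega : measurableType d) (n : nat) (X : 'I_n -> {mfun Omega >-> R})
    (a : 'rV[R]_n) :
  (fun w => (a *m sample X w) 0 0) = (fun w => \sum_(i < n) a 0 i * X i w).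
Proof.
by apply/funext => w; rewrite mxE; apply: eq_bigr => i _; rewrite mxE.
Qed.

Lemma measurable_projection (R : realType) (d : measure_display)
    (Omega : measurableType d) (n : nat) (X : 'I_n -> {mfun Omega >-> R})
    (a : 'rV[R]_n) : measurable_fun setT (fun w => (a *m sample X w) 0 0).
Proof.
rewrite projection_sum.
by apply: measurable_sum => i; exact: measurable_funM.
Qed.

Lemma gaussian_tail (R : realType) (d : measure_display)
    (Omega : measurableType d) (P : probability Omega R) (n : nat)
    (X : 'I_n -> {mfun Omega >-> R}) (mu : 'cV[R]_n) (Sigma : 'M[R]_n)
    (a : 'rV[R]_n) (r : R) :
  gaussian_with P X mu Sigma -> (a *m Sigma *m a^T) 0 0 = 1 -> 28 <= r ->
  (P [set w | (r <= `|(a *m sample X w) 0 0 - (a *m mu) 0 0|)%R] <=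
   (2 * expR (- (r ^+ 2 / 128)))%:E)%E.
Proof.
move=> gX a1 r28; have [gauss _ _] := gX; have [m [s law]] := gauss (a 0).
apply: (@normal_law_tail _ _ _ _ _ m s) => //.
- exact: measurable_projection.
- move=> A mA; rewrite -law//; congr (P _).
  by rewrite -[RHS]/((fun w => \sum_(i < n) a 0 i * X i w) @^-1` A) -projection_sum.
- by rewrite (second_moment a gX) a1.
Qed.

(** * Positive definiteness of Toeplitz matrices *)

Lemma measurable_cos_mul (R : realType) (x : R) (D : set R) :
  measurable_fun D (fun w => cos (x * w)).
Proof.
apply: measurable_funTS; apply: measurableT_comp.
  by apply: continuous_measurable_fun; exact: continuous_cos.
exact: measurable_funM.
Qed.

Lemma sin_npi (R : realType) (n : nat) : sin (n%:R * pi : R) = 0.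
Proof.
elim: n => [|n IH]; first by rewrite mul0r sin0.
by rewrite -natr1 mulrDl mul1r sinD IH sinpi mul0r mulr0 addr0.
Qed.

Lemma Rintegral_cos (R : realType) (n : nat) :
  \int[lebesgue_measure]_(w in `[(- pi)%R, pi%R]) cos (n%:R * w) =
  (if n == 0%N then 2 * pi else 0 : R).
Proof.
have pi0 := pi_gt0 R.
have Npi : - pi < pi :> R by lra.
case: eqVneq => [->|n0].
  under eq_Rintegral do rewrite mul0r cos0.
  rewrite Rintegral_cst//= lebesgue_measure_itv/= lte_fin Npi.
  rewrite mul1r /=; lra.
have nR : n%:R != 0 :> R by rewrite pnatr_eq0.
pose F (w : R) := n%:R^-1 * sin (n%:R * w).
have dF (x : R) : is_derive x 1 F (cos (n%:R * x)).
  have : is_derive x 1 (n%:R^-1 \*: ((@sin R) \o (n%:R \*: (@id R))))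
                       (n%:R^-1 *: (cos (n%:R *: x) * (n%:R *: 1))).
    by apply: is_deriveZ; apply: is_derive1_comp.
  by rewrite /GRing.scale/= mulr1 mulrCA mulVf// mulr1.
have cF : continuous F.
  by move=> x; apply: differentiable_continuous; apply/derivable1_diffP.
rewrite /Rintegral (@continuous_FTC2 _ _ F)//=.
- by rewrite /F mulrN sinN sin_npi oppr0 mulr0 subrr.
- apply: continuous_subspaceT => x.
  apply: continuous_comp; last exact: continuous_cos.
  by apply: continuousM; [exact: cst_continuous|exact: id].
- split => [x _||]; first by apply: ex_derive.
    by apply: cvg_at_right_filter; exact: cF.
  by apply: cvg_at_left_filter; exact: cF.
- by move=> x _; rewrite derive1E; apply: derive_val.
Qed.

Lemma Rintegral_sum (R : realType) (d : measure_display) (T : measurableType d)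
    (mu : {measure set T -> \bar R}) (D : set T) (I : Type) (s : seq I)
    (h : I -> T -> R) : measurable D ->
  (forall i, mu.-integrable D (EFin \o h i)) ->
  \int[mu]_(x in D) (\sum_(i <- s) h i x) =
  \sum_(i <- s) \int[mu]_(x in D) h i x.
Proof.
move=> mD ih; rewrite /Rintegral.
under eq_integral do rewrite -sumEFin.
rewrite integral_sum// sum_fine// => i _.
exact: (integrable_fin_num mD (ih i)).
Qed.

Lemma integrable_mul_cos (R : realType) (f : R -> R) (M x : R) :
  measurable_fun `[(- pi)%R, pi%R] f ->
  (forall w, w \in `[- pi, pi] -> `|f w| <= M) ->
  lebesgue_measure.-integrable `[(- pi)%R, pi%R]
    (EFin \o (fun w => f w * cos (x * w))).
Proof.
move=> mf fM; apply: measurable_bounded_integrable => //=.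
- by rewrite lebesgue_measure_itv/=; case: ifP => _; rewrite -?EFinB ltry.
- by apply: measurable_funM => //; exact: measurable_cos_mul.
exists M; split; first exact: num_real.
move=> y My w wI; apply: le_trans (ltW My).
rewrite normrM -[leRHS]mulr1 ler_pM ?fM ?inE//.
by rewrite ler_norml cos_geN1 cos_le1.
Qed.

Definition lag (n : nat) (i j : 'I_n) : int := `|i%:Z - j%:Z|.

Lemma cos_lag (R : realType) (n : nat) (i j : 'I_n) (w : R) :
  cos ((lag i j)%:~R * w) =
  cos (i%:R * w) * cos (j%:R * w) + sin (i%:R * w) * sin (j%:R * w).
Proof.
have abs_cos (k : int) : cos (`|k|%:~R * w) = cos (k%:~R * w).
  by case: (ger0P k) => _ //; rewrite intrN mulNr cosN.
by rewrite abs_cos rmorphB /= mulrBl cosB.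
Qed.

(** The kernel is the squared modulus of the trigonometric polynomial with coefficients
[x]. *)
Lemma trig_kernel_ge0 (R : realType) (n : nat) (x : 'I_n -> R) (w : R) :
  0 <= \sum_i \sum_j x i * x j * cos ((lag i j)%:~R * w).
Proof.
rewrite (_ : \sum_i _ = (\sum_i x i * cos (i%:R * w)) ^+ 2 +
                        (\sum_i x i * sin (i%:R * w)) ^+ 2).
  by rewrite addr_ge0// sqr_ge0.
rewrite !expr2 !mulr_suml -big_split/=; apply: eq_bigr => i _.
rewrite !mulr_sumr -big_split/=; apply: eq_bigr => j _.
by rewrite cos_lag; ring.
Qed.

Lemma integrable_trig_row (R : realType) (f : R -> R) (M : R) (n : nat)
    (x : 'I_n -> R) (i : 'I_n) :
  measurable_fun `[(- pi)%R, pi%R] f ->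
  (forall w, w \in `[- pi, pi] -> `|f w| <= M) ->
  lebesgue_measure.-integrable `[(- pi)%R, pi%R]
    (EFin \o (fun w => \sum_j x i * x j * (f w * cos ((lag i j)%:~R * w)))) /\
  forall j, lebesgue_measure.-integrable `[(- pi)%R, pi%R]
    (EFin \o (fun w => x i * x j * (f w * cos ((lag i j)%:~R * w)))).
Proof.
move=> mf fM.
have int j : lebesgue_measure.-integrable `[(- pi)%R, pi%R]
    (EFin \o (fun w => x i * x j * (f w * cos ((lag i j)%:~R * w)))).
  rewrite (_ : _ \o _ = (fun w : R => (x i * x j)%:E *
    (f w * cos ((lag i j)%:~R * w))%:E)%E).
    by apply: integrableZl => //; exact: (integrable_mul_cos (lag i j)%:~R mf fM).
  by apply/funext => w /=; rewrite EFinM.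
split=> //; rewrite (_ : _ \o _ = (fun w : R => \sum_(j < n)
    (x i * x j * (f w * cos ((lag i j)%:~R * w)))%:E)%E).
  by apply: integrable_sum => // j _; exact: int.
by apply/funext => w /=; rewrite sumEFin.
Qed.

Lemma integrable_trig_form (R : realType) (f : R -> R) (M : R) (n : nat)
    (x : 'I_n -> R) :
  measurable_fun `[(- pi)%R, pi%R] f ->
  (forall w, w \in `[- pi, pi] -> `|f w| <= M) ->
  lebesgue_measure.-integrable `[(- pi)%R, pi%R] (EFin \o (fun w =>
    \sum_i \sum_j x i * x j * (f w * cos ((lag i j)%:~R * w)))).
Proof.
move=> mf fM; rewrite (_ : _ \o _ = (fun w : R => \sum_(i < n)
    (\sum_j x i * x j * (f w * cos ((lag i j)%:~R * w)))%:E)%E).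
  by apply: integrable_sum => // i _; exact: (integrable_trig_row x i mf fM).1.
by apply/funext => w /=; rewrite sumEFin.
Qed.

Lemma trig_form_integral (R : realType) (f : R -> R) (M : R) (n : nat)
    (x : 'I_n -> R) :
  measurable_fun `[(- pi)%R, pi%R] f ->
  (forall w, w \in `[- pi, pi] -> `|f w| <= M) ->
  \sum_i \sum_j x i * x j * \int[lebesgue_measure]_(w in `[(- pi)%R, pi%R])
    (f w * cos ((lag i j)%:~R * w)) =
  \int[lebesgue_measure]_(w in `[(- pi)%R, pi%R])
    (\sum_i \sum_j x i * x j * (f w * cos ((lag i j)%:~R * w))).
Proof.
move=> mf fM; rewrite Rintegral_sum//=; last first.
  by move=> i; exact: (integrable_trig_row x i mf fM).1.
apply: eq_bigr => i _; rewrite Rintegral_sum//=; last first.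
  by move=> j; exact: (integrable_trig_row x i mf fM).2.
apply: eq_bigr => j _.
by rewrite RintegralZl//; exact: (integrable_mul_cos (lag i j)%:~R mf fM).
Qed.

Lemma measurable_fourier_limit (R : realType) (f : R -> R) :
  (forall w, w \in `[- pi, pi] ->
     (fun N : nat => fourier_sum f N w) @ \oo --> f w) ->
  measurable_fun `[(- pi)%R, pi%R] f.
Proof.
move=> fS; apply: (@measurable_fun_cvg _ _ _ _ (fun N => fourier_sum f N)) => //.
move=> N; apply: measurable_funD => //; apply: measurable_sum => m.
apply: measurable_funD; apply: measurable_funM => //; exact: measurable_cos_mul.
Qed.

(** The form is the mean of [f] against the squared modulus of the trigonometric
polynomial with coefficients [x]; the mean of that modulus is [\sum_i x i ^ 2] by
orthogonality. *)
Lemma toeplitz_form_ge (R : realType) (f : R -> R) (m M : R) (n : nat)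
    (x : 'I_n -> R) :
  measurable_fun `[(- pi)%R, pi%R] f ->
  (forall w, w \in `[- pi, pi] -> m <= f w <= M) -> 0 <= m ->
  m * \sum_i x i ^+ 2 <= \sum_i \sum_j x i * x j * toeplitz n f i j.
Proof.
move=> mf fmM m0; have pi0 := pi_gt0 R.
have fM w : w \in `[- pi, pi] -> `|f w| <= M.
  by move=> /fmM /andP[fm fM]; rewrite ger0_norm// (le_trans m0).
have cM w : w \in `[(- pi : R), pi] -> `|cst m w| <= m.
  by move=> _; rewrite ger0_norm.
have -> : \sum_i \sum_j x i * x j * toeplitz n f i j =
    (2 * pi)^-1 * \sum_i \sum_j x i * x j *
    \int[lebesgue_measure]_(w in `[(- pi)%R, pi%R])
      (f w * cos ((lag i j)%:~R * w)).
  rewrite mulr_sumr; apply: eq_bigr => i _; rewrite mulr_sumr.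
  by apply: eq_bigr => j _; rewrite mxE /fourier_coef -/(lag i j) mulrCA.
have -> : m * \sum_i x i ^+ 2 =
    (2 * pi)^-1 * \sum_i \sum_j x i * x j *
    \int[lebesgue_measure]_(w in `[(- pi)%R, pi%R])
      (cst m w * cos ((lag i j)%:~R * w)).
  rewrite !mulr_sumr; apply: eq_bigr => i _.
  have Eij j : \int[lebesgue_measure]_(w in `[(- pi)%R, pi%R])
      (cst m w * cos ((lag i j)%:~R * w)) = m * (if j == i then 2 * pi else 0).
    rewrite RintegralZl//=; last first.
      rewrite (_ : _ \o _ =
          EFin \o (fun w : R => cst 1 w * cos ((lag i j)%:~R * w))).
        by apply: (@integrable_mul_cos _ _ 1) => // w _; rewrite normr1.
      by apply/funext => w /=; rewrite mul1r.
    rewrite {1}/lag -abszE Rintegral_cos; congr (m * (if _ then _ else _)).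
    by rewrite absz_eq0 subr_eq0 eqz_nat eq_sym.
  under [in RHS]eq_bigr => j _ do rewrite Eij.
  rewrite (bigD1 i)//= eqxx big1 => [|j /negbTE ->]; last by rewrite !mulr0.
  by field; lra.
rewrite (trig_form_integral _ mf fM) (trig_form_integral _ _ cM)//.
rewrite ler_pM2l ?invr_gt0 ?mulr_gt0//.
apply: le_Rintegral => //.
- by apply: (integrable_trig_form x _ cM).
- exact: integrable_trig_form x mf fM.
move=> w wI.
rewrite -subr_ge0 -sumrB (_ : \sum_i _ = (f w - m) *
   \sum_i \sum_j x i * x j * cos ((lag i j)%:~R * w)).
  rewrite mulr_ge0 ?trig_kernel_ge0// subr_ge0.
  by have /andP[] := fmM _ wI.
rewrite mulr_sumr; apply: eq_bigr => i _; rewrite mulr_sumr -sumrB.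
by apply: eq_bigr => j _ /=; ring.
Qed.

(** * Toeplitz sums as Fourier partial sums *)

Definition toeplitz_sum (R : realType) (f : R -> R) (k : nat) : R :=
  \sum_(0 <= i < k) \sum_(0 <= j < k) fourier_coef f `|i%:Z - j%:Z|.

Lemma fourier_coefN (R : realType) (f : R -> R) (k : int) :
  fourier_coef f (- k) = fourier_coef f k.
Proof.
congr (_ * _); apply: eq_Rintegral => w _.
by rewrite intrN mulNr cosN.
Qed.

(** Enlarging the matrix from size [k] to size [k + 1] adds one row and one column,
whose entries are those of the partial sum of order [k] at 0. *)
Lemma toeplitz_sum_cesaro (R : realType) (f : R -> R) (k : nat) :
  toeplitz_sum f k = series (fun N => fourier_sum f N 0) k.
Proof.
rewrite /toeplitz_sum /series/=; elim: k => [|k IH]; first by rewrite !big_geq.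
rewrite !big_nat_recr//= -IH.
under eq_bigr do rewrite big_nat_recr//=.
rewrite big_split/= -!addrA; congr (_ + _).
have row : \sum_(0 <= j < k) fourier_coef f `|k%:Z - j%:Z| =
           \sum_(1 <= m < k.+1) fourier_coef f m%:Z.
  rewrite big_nat_rev big_add1/=; apply: eq_big_nat => j /andP[_ jk].
  by rewrite add0n -subzn// subKr.
have -> : \sum_(0 <= i < k) fourier_coef f `|i%:Z - k%:Z| =
          \sum_(0 <= j < k) fourier_coef f `|k%:Z - j%:Z|.
  by apply: eq_bigr => i _; rewrite distrC.
rewrite row subrr normr0 /fourier_sum.
under [in RHS]eq_bigr do rewrite !mulr0 cos0 !mulr1 fourier_coefN.
by rewrite big_split/=; ring.
Qed.

Lemma toeplitz_sum_le (R : realType) (f : R -> R) : 0 < f 0 ->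
  (fun N : nat => fourier_sum f N 0) @ \oo --> f 0 ->
  exists k0 : nat, forall k, (k0 <= k)%N -> toeplitz_sum f k <= 2 * (k%:R * f 0).
Proof.
move=> f0 /cesaro /cvgrPdist_lt /(_ _ f0) [k0 _ H].
exists k0.+1 => -[//|k] kk0; rewrite toeplitz_sum_cesaro.
have := H k kk0; rewrite /= /arithmetic_mean/= distrC => /ltr_normlW.
rewrite ltrBlDr -ltr_pdivlMl ?invr_gt0// invrK => /ltW /le_trans; apply.
by rewrite mulrDr; lra.
Qed.

Lemma sum_indic_lt (R : realType) (n t : nat) (F : nat -> R) : (t <= n)%N ->
  \sum_(i < n) (i < t)%N%:R * F i = \sum_(0 <= i < t) F i.
Proof.
move=> tn; rewrite -(big_mkord xpredT (fun i => (i < t)%N%:R * F i)).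
rewrite (big_cat_nat _ (n := t))//= [X in _ + X]big_nat_cond [X in _ + X]big1.
  by rewrite addr0; apply: eq_big_nat => i /andP[_ ->]; rewrite mul1r.
by move=> i /andP[/andP[ti _] _]; rewrite ltnNge ti mul0r.
Qed.

Lemma sum_indic_ge (R : realType) (n t : nat) (F : nat -> R) : (t <= n)%N ->
  \sum_(i < n) (t <= i)%N%:R * F i = \sum_(0 <= i < n - t) F (i + t)%N.
Proof.
move=> tn; rewrite -(big_mkord xpredT (fun i => (t <= i)%N%:R * F i)).
rewrite (big_cat_nat _ (n := t))//= [X in X + _]big_nat_cond [X in X + _]big1.
  rewrite add0r -{1}[t]add0n big_addn; apply: eq_big_nat => i _.
  by rewrite leq_addl mul1r.
by move=> i /andP[/andP[_ it] _]; rewrite leqNgt it mul0r.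
Qed.

(** With [u] and [v] the indicators of the two segments, [zeta = u - v] and the
parallelogram identity expresses its form through those of [u], [v] and [u + v]; the
last one is nonnegative. *)
Lemma toeplitz_zeta_le (R : realType) (f : R -> R) (n t : nat) : (t <= n)%N ->
  (forall x : 'I_n -> R, 0 <= \sum_i \sum_j x i * x j * toeplitz n f i j) ->
  \sum_i \sum_j zeta R n t i 0 * zeta R n t j 0 * toeplitz n f i j <=
  2 * (toeplitz_sum f t + toeplitz_sum f (n - t)).
Proof.
move=> tn psd; pose T (i j : nat) := fourier_coef f `|i%:Z - j%:Z|.
pose Q (x y : nat -> R) := \sum_(i < n) x i * \sum_(j < n) y j * T i j.
pose u (i : nat) : R := (t <= i)%N%:R; pose v (i : nat) : R := (i < t)%N%:R.
have -> : toeplitz_sum f t = Q v v.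
  rewrite /Q (sum_indic_lt (fun i => \sum_(j < n) v j * T i j))//.
  by apply: eq_bigr => i _; rewrite (sum_indic_lt (T i)).
have -> : toeplitz_sum f (n - t) = Q u u.
  rewrite /Q (sum_indic_ge (fun i => \sum_(j < n) u j * T i j))//.
  apply: eq_bigr => i _; rewrite (sum_indic_ge (T _))//.
  by apply: eq_bigr => j _; rewrite /T !PoszD opprD addrACA subrr addr0.
have zetaE (i : 'I_n) : zeta R n t i 0 = u i - v i.
  by rewrite mxE /u /v; case: ltnP => _ /=; rewrite ?sub0r ?subr0.
have TE (i j : 'I_n) : toeplitz n f i j = T i j by rewrite mxE.
(* The entries stay abstract from here on, since unfolding them is costly. *)
have := psd (fun i => u i + v i); rewrite {psd}/Q; move: T TE u v zetaE.
move=> T TE u v zetaE psd.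
have -> : \sum_i \sum_j zeta R n t i 0 * zeta R n t j 0 * toeplitz n f i j =
    2 * (\sum_(i < n) v i * \sum_(j < n) v j * T i j +
         \sum_(i < n) u i * \sum_(j < n) u j * T i j) -
    \sum_(i < n) \sum_(j < n) (u i + v i) * (u j + v j) * toeplitz n f i j.
  rewrite -big_split/= mulr_sumr -sumrB; apply: eq_bigr => i _.
  rewrite !mulr_sumr -big_split/= mulr_sumr -sumrB; apply: eq_bigr => j _.
  by rewrite TE !zetaE; ring.
by rewrite lerBlDr lerDl.
Qed.

(** * The form of the inverse matrix *)

Definition quad_form (R : realType) (n : nat) (A : 'M[R]_n) (x : 'cV[R]_n) : R :=
  (x^T *m A *m x) 0 0.

Definition positive_definite (R : realType) (n : nat) (A : 'M[R]_n) : Prop :=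
  A^T = A /\ forall x : 'cV[R]_n, x != 0 -> 0 < quad_form A x.

Lemma positive_definite_unit (R : realType) (n : nat) (A : 'M[R]_n) :
  positive_definite A -> A \in unitmx.
Proof.
move=> [_ pos]; rewrite -row_free_unit; apply: inj_row_free => v vA.
apply: contrapT => /eqP v0; have := pos v^T.
rewrite trmx_eq0 /quad_form trmxK vA mul0mx mxE ltxx => /(_ v0).
by [].
Qed.

Lemma inverse_form_gt0 (R : realType) (n : nat) (A : 'M[R]_n) (z : 'cV[R]_n) :
  positive_definite A -> z != 0 -> 0 < quad_form (invmx A) z.
Proof.
move=> pA z0; have uA := positive_definite_unit pA; have [sym pos] := pA.
have -> : quad_form (invmx A) z = quad_form A (invmx A *m z).
  by rewrite /quad_form trmx_mul trmx_inv sym !mulmxA mulmxKV.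
apply: pos; apply: contra_neq z0 => Az.
by rewrite -(mulKVmx uA z) Az mulmx0.
Qed.

(** The Cauchy-Schwarz inequality for the form of [A], between [invmx A *m z] and [z]:
the form is nonnegative at the difference of the first vector and its projection on
the second one. *)
Lemma inverse_form_ge (R : realType) (n : nat) (A : 'M[R]_n) (z : 'cV[R]_n) :
  positive_definite A ->
  ((z^T *m z) 0 0) ^+ 2 <= quad_form (invmx A) z * quad_form A z.
Proof.
move=> pA; have [->|z0] := eqVneq z 0.
  by rewrite /quad_form !mulmx0 !mxE expr0n mulr0.
have uA := positive_definite_unit pA; have [sym pos] := pA.
have Q0 := pos _ z0; set Q := quad_form A z in Q0 *.
set N := (z^T *m z) 0 0; set q := quad_form (invmx A) z.
(* The coefficient that minimizes the form at [y]. *)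
pose l := N / Q; pose y := invmx A *m z - l *: z.
have : 0 <= quad_form A y.
  have [->|/pos /ltW //] := eqVneq y 0.
  by rewrite /quad_form mulmx0 mxE.
have -> : quad_form A y = q - l * N - l * N + l * l * Q.
  have yTA : y^T *m A = z^T - l *: (z^T *m A).
    rewrite linearB/= linearZ/= trmx_mul trmx_inv sym mulmxBl mulmxKV//.
    by rewrite -scalemxAl.
  rewrite /quad_form yTA mulmxBl -scalemxAl !mulmxBr -!scalemxAr !mulmxA mulmxK//.
  rewrite /N /Q /q /quad_form; move: (z^T *m invmx A *m z) (z^T *m A *m z).
  by move: (z^T *m z) => N' q' Q'; rewrite !mxE; ring.
have -> : l * l * Q = l * N by rewrite /l; field; rewrite gt_eqF.
by rewrite subrK subr_ge0 /l mulrAC ler_pdivrMr// expr2.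
Qed.

(** * The signal carried by a change point *)

Lemma quad_formE (R : realType) (n : nat) (A : 'M[R]_n) (x : 'cV[R]_n) :
  quad_form A x = \sum_i \sum_j x i 0 * x j 0 * A i j.
Proof.
rewrite /quad_form mxE exchange_big; apply: eq_bigr => j _.
rewrite mxE mulr_suml; apply: eq_bigr => i _; rewrite mxE; ring.
Qed.

Lemma toeplitz_positive_definite (R : realType) (f : R -> R) (m M : R) (n : nat) :
  measurable_fun `[(- pi)%R, pi%R] f ->
  (forall w, w \in `[- pi, pi] -> m <= f w <= M) -> 0 < m ->
  positive_definite (toeplitz n f).
Proof.
move=> mf fmM m0; split.
  by apply/matrixP => i j; rewrite !mxE distrC.
move=> x x0; rewrite quad_formE.
apply: lt_le_trans (toeplitz_form_ge (fun i => x i 0) mf fmM (ltW m0)).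
rewrite mulr_gt0// lt_def sumr_ge0 ?andbT => [|i _]; last exact: sqr_ge0.
apply: contra_neq x0 => /eqP; rewrite psumr_eq0 => [/allP x0|i _];
  last exact: sqr_ge0.
apply/matrixP => i j; rewrite ord1 mxE.
by have := x0 i (mem_index_enum i); rewrite sqrf_eq0 => /eqP.
Qed.

Lemma zeta_norm (R : realType) (n t : nat) :
  ((zeta R n t)^T *m zeta R n t) 0 0 = n%:R.
Proof.
rewrite mxE -[in RHS](card_ord n) -sumr_const; apply: eq_bigr => i _.
by rewrite !mxE; case: ifP => _; rewrite ?mulrNN mulr1.
Qed.

(** The Cauchy-Schwarz bound turns an upper bound of the Toeplitz form at [zeta] into
a lower bound of the inverse form, which is the squared signal to noise ratio. *)
Lemma zeta_inverse_form_ge (R : realType) (f : R -> R) (m M : R) (n t k0 : nat) :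
  measurable_fun `[(- pi)%R, pi%R] f ->
  (forall w, w \in `[- pi, pi] -> m <= f w <= M) -> 0 < m ->
  (forall k, (k0 <= k)%N -> toeplitz_sum f k <= 2 * (k%:R * f 0)) ->
  (k0 <= t)%N -> (k0 <= n - t)%N -> (0 < t < n)%N ->
  n%:R <= 4 * f 0 * quad_form (invmx (toeplitz n f)) (zeta R n t) /\
  0 < quad_form (invmx (toeplitz n f)) (zeta R n t).
Proof.
move=> mf fmM m0 sec kt knt /andP[t0 tn].
have pT := toeplitz_positive_definite n mf fmM m0.
have n0 : 0 < n%:R :> R by rewrite ltr0n (leq_trans t0)// ltnW.
have z0 : zeta R n t != 0.
  by apply: contraTneq n0 => z0; rewrite -(zeta_norm R n t) z0 mulmx0 mxE ltxx.
have q0 := inverse_form_gt0 pT z0; split => //.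
have := inverse_form_ge (zeta R n t) pT; rewrite zeta_norm.
have Q4 : quad_form (toeplitz n f) (zeta R n t) <= 4 * f 0 * n%:R.
  rewrite quad_formE; apply: le_trans (toeplitz_zeta_le (ltnW tn) _) _.
    move=> x; apply: le_trans (toeplitz_form_ge x mf fmM (ltW m0)).
    by rewrite mulr_ge0 ?(ltW m0)// sumr_ge0// => i _; exact: sqr_ge0.
  have := lerD (sec _ kt) (sec _ knt); rewrite natrB ?(ltnW tn)//; lra.
move/le_trans/(_ (ler_wpM2l (ltW q0) Q4)).
rewrite expr2 mulrA ler_pM2r// mulrC; lra.
Qed.

Lemma change_point_bounds (R : realType) (alpha : R) (n t : nat) :
  0 < alpha -> change_point alpha n t ->
  [/\ (0 < t < n)%N, alpha * n%:R < t%:R & alpha * n%:R < (n - t)%:R].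
Proof.
move=> a0 /andP[/andP[t0 tn]] amin.
have at0 : alpha * n%:R < t%:R by rewrite (lt_le_trans amin)// ler_nat geq_minl.
have ant : alpha * n%:R < (n - t)%:R.
  by rewrite (lt_le_trans amin)// ler_nat geq_minr.
split=> //; rewrite t0/= -subn_gt0 -(ltr0n R) (le_lt_trans _ ant)//.
by rewrite mulr_ge0// ltW.
Qed.

(** With [k] the least integer above [alpha n], change points lie between [k] and
[n - k]. *)
Lemma change_point_count (R : realType) (alpha : R) (n : nat) :
  0 < alpha < 2^-1 ->
  (count (change_point alpha n) (index_iota 1 n.+1))%:R <=
  n%:R * (1 - 2 * alpha) + 1.
Proof.
(* Strictly above [alpha n], as change points satisfy strict inequalities. *)
move=> /andP[a0 a2]; pose k := (Num.truncn (alpha * n%:R)).+1.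
have ka : alpha * n%:R < k%:R by rewrite truncnS_gt.
have kle (u : nat) : alpha * n%:R < u%:R -> (k <= u)%N.
  by move=> au; rewrite /k truncn_lt_nat// mulr_ge0// ltW.
have sub : (count (change_point alpha n) (index_iota 1 n.+1) <=
            n.+1 - k.*2)%N.
  rewrite -size_filter -[leqRHS](size_iota k).
  apply: uniq_leq_size; first by rewrite filter_uniq// iota_uniq.
  move=> t; rewrite mem_filter => /andP[/(change_point_bounds a0) [tn at0 ant] _].
  move: (kle _ at0) (kle _ ant); rewrite mem_iota -addnn; lia.
have n0 : 0 <= n%:R :> R by [].
have [kn|kn] := leqP k.*2 n.+1.
  apply: le_trans (_ : (n.+1 - k.*2)%:R <= _); first by rewrite ler_nat.
  rewrite natrB// -addnn natrD -natr1; lra.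
have -> : count (change_point alpha n) (index_iota 1 n.+1) = 0%N by lia.
by nra.
Qed.

(** * Error of the test *)

(** The union bound. Measurability is part of the conclusion because both are proved by
the same induction, each step of which needs it. *)
Lemma measure_bigmax_ge (R : realType) (d : measure_display)
    (Omega : measurableType d) (P : probability Omega R) (r : R) (e : R)
    (p : pred nat) (s : seq nat) (F : nat -> Omega -> R) : 0 < r ->
  (forall t, p t -> measurable [set w | r <= F t w]) ->
  (forall t, p t -> P [set w | (r <= F t w)%R] <= e%:E)%E ->
  measurable [set w | r <= \big[Num.max/0]_(t <- s | p t) F t w] /\
  (P [set w | (r <= \big[Num.max/0]_(t <- s | p t) F t w)%R] <=
   ((count p s)%:R * e)%:E)%E.
Proof.
move=> r0 mF PF; elim: s => [|t s [mS PS]].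
  rewrite (_ : [set w | _] = set0) ?measure0 ?mul0r//.
  by apply/seteqP; split => w //=; rewrite big_nil leNgt r0.
case pt : (p t); last first.
  rewrite /= pt (_ : [set w | _] =
    [set w | r <= \big[Num.max/0]_(t <- s | p t) F t w])//.
  by apply/seteqP; split => w /=; rewrite big_cons pt.
have -> : [set w | r <= \big[Num.max/0]_(t <- t :: s | p t) F t w] =
    [set w | r <= F t w] `|`
    [set w | r <= \big[Num.max/0]_(t <- s | p t) F t w].
  apply/seteqP; split => w /=; rewrite big_cons pt le_max => /orP //.
split; first by apply: measurableU => //; exact: mF.
apply: le_trans (measureU2 P (mF _ pt) mS) _.
by rewrite /= pt add1n -natr1 mulrDl mul1r addrC EFinD leeD// PF.
Qed.

(** Times the sample, this row vector gives the normalized statistic at [t], which makes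
the general tail bound for linear functionals apply to it. *)
Definition glrt_weight (R : realType) (n : nat) (Sigma : 'M[R]_n) (t : nat) :
    'rV[R]_n :=
  (Num.sqrt (quad_form (invmx Sigma) (zeta R n t)))^-1 *:
  ((zeta R n t)^T *m invmx Sigma).

Lemma glrt_ratioE (R : realType) (n : nat) (Sigma : 'M[R]_n) (t : nat)
    (x : 'cV[R]_n) :
  ((zeta R n t)^T *m invmx Sigma *m x) 0 0 /
    Num.sqrt (((zeta R n t)^T *m invmx Sigma *m zeta R n t) 0 0) =
  (glrt_weight Sigma t *m x) 0 0.
Proof. by rewrite /glrt_weight /quad_form -scalemxAl [in RHS]mxE mulrC. Qed.

Lemma glrt_weight_variance (R : realType) (n : nat) (Sigma : 'M[R]_n) (t : nat) :
  positive_definite Sigma -> 0 < quad_form (invmx Sigma) (zeta R n t) ->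
  (glrt_weight Sigma t *m Sigma *m (glrt_weight Sigma t)^T) 0 0 = 1.
Proof.
move=> pSigma q0; have uS := positive_definite_unit pSigma.
have [sym _] := pSigma.
rewrite /glrt_weight -!scalemxAl mulmxKV// linearZ/= trmx_mul trmx_inv sym trmxK.
rewrite -scalemxAr mulmxA mxE [X in _ * X]mxE -/(quad_form _ _).
rewrite mulrA -invfM -expr2 sqr_sqrtr ?ltW//.
by rewrite mulVf// gt_eqF.
Qed.

Lemma glrt_weight_mean (R : realType) (n : nat) (Sigma : 'M[R]_n) (b : R)
    (t : nat) : 0 < quad_form (invmx Sigma) (zeta R n t) ->
  (glrt_weight Sigma t *m ((b / 2) *: zeta R n t)) 0 0 =
  b / 2 * Num.sqrt (quad_form (invmx Sigma) (zeta R n t)).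
Proof.
move=> q0; rewrite -scalemxAr /glrt_weight -scalemxAl mxE.
rewrite [X in _ * X]mxE -/(quad_form _ _).
have s0 : 0 < Num.sqrt (quad_form (invmx Sigma) (zeta R n t)).
  by rewrite sqrtr_gt0.
by rewrite -{2}(sqr_sqrtr (ltW q0)) expr2 mulKf// gt_eqF.
Qed.

(** Each false alarm is a deviation by [r] of some functional from its mean 0. A miss
at [t] confines the functional to [[-r, r]] while its mean has modulus at least [2 r],
so it is a deviation by [r] too. This makes as many tails as change points, plus
one. *)
Lemma detection_error_le (R : realType) (n : nat) (alpha b r : R)
    (Sigma : 'M[R]_n) (d : measure_display) (Omega : measurableType d)
    (X : 'I_n -> {mfun Omega >-> R}) (P0 : probability Omega R)
    (P1 : nat -> probability Omega R) :
  positive_definite Sigma -> 28 <= r ->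
  (forall t, change_point alpha n t ->
     0 < quad_form (invmx Sigma) (zeta R n t) /\
     16 * r ^+ 2 <= b ^+ 2 * quad_form (invmx Sigma) (zeta R n t)) ->
  gaussian_with P0 X 0 Sigma ->
  (forall t : nat, change_point alpha n t ->
     gaussian_with (P1 t) X ((b / 2) *: zeta R n t) Sigma) ->
  (detection_error alpha X P0 P1 (glrt alpha Sigma (r ^+ 2)) <=
   (((count (change_point alpha n) (index_iota 1 n.+1))%:R + 1) *
    (2 * expR (- (r ^+ 2 / 128))))%:E)%E.
Proof.
move=> pSigma r28 qb g0 g1; have rp : 0 < r by lra.
have r0 := ltW rp.
set e := 2 * _; have e0 : 0 <= e by rewrite mulr_ge0 ?expR_ge0.
pose F t w := `|(glrt_weight Sigma t *m sample X w) 0 0| ^+ 2.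
have statE w : glrt_stat alpha Sigma (sample X w) =
    \big[Num.max/0]_(1 <= t < n.+1 | change_point alpha n t) F t w.
  by apply: eq_bigr => t _; rewrite glrt_ratioE.
have FE t : [set w | r ^+ 2 <= F t w] =
    [set w | r <= `|(glrt_weight Sigma t *m sample X w) 0 0 - 0|].
  by apply/seteqP; split=> w /=; rewrite subr0 /F ler_pXn2r ?nnegrE ?normr_ge0.
have mF t : measurable [set w | r ^+ 2 <= F t w].
  by rewrite FE; apply: measurable_comp_dist_ge; exact: measurable_projection.
have H0 t : change_point alpha n t ->
    (P0 [set w | (r ^+ 2 <= F t w)%R] <= e%:E)%E.
  move=> /qb[q0 _]; rewrite FE.
  have := gaussian_tail g0 (glrt_weight_variance pSigma q0) r28.
  by rewrite mulmx0 mxE.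
have r20 : 0 < r ^+ 2 by exact: exprn_gt0.
have [mT PT] := measure_bigmax_ge (index_iota 1 n.+1) r20 (fun t _ => mF t) H0.
have TE : [set w | glrt alpha Sigma (r ^+ 2) (sample X w)] =
    [set w | r ^+ 2 <= \big[Num.max/0]_(t <- index_iota 1 n.+1 |
                                         change_point alpha n t) F t w].
  by apply/seteqP; split => w /=; rewrite /glrt statE.
rewrite /detection_error mulrDl mul1r EFinD; apply: leeD; first by rewrite TE.
apply: (big_ind (fun x => (x <= e%:E)%E)); first by rewrite lee_fin.
  by move=> x y xe ye; rewrite ge_max xe.
move=> t pt; have [q0 bq] := qb t pt.
have := gaussian_tail (g1 t pt) (glrt_weight_variance pSigma q0) r28.
rewrite glrt_weight_mean//; apply: le_trans; apply: le_measure; rewrite ?inE.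
- rewrite (_ : [set w | _] = ~` [set w | glrt alpha Sigma (r ^+ 2) (sample X w)]).
    by rewrite TE; exact: measurableC.
  by apply/seteqP; split => w /= /negP.
- by apply: measurable_comp_dist_ge; exact: measurable_projection.
move=> w /=; rewrite /glrt statE -ltNge => Tw.
have : F t w < r ^+ 2.
  apply: le_lt_trans Tw.
  apply: (@le_bigmax_seq _ _ _ _ 0 t (change_point alpha n) (F^~ w)) => //.
  by case/andP: pt; rewrite mem_index_iota ltnS.
rewrite /F ltr_pXn2r ?nnegrE ?normr_ge0// => yr.
set q := quad_form _ _ in q0 bq *.
have : 2 * r <= `|b / 2 * Num.sqrt q|.
  rewrite -(@ler_pXn2r _ 2) ?nnegrE ?normr_ge0 ?mulr_ge0// real_normK ?num_real//.
  have -> : (b / 2 * Num.sqrt q) ^+ 2 = b ^+ 2 * q / 4.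
    by rewrite -[in RHS](sqr_sqrtr (ltW q0)); field.
  by rewrite ler_pdivlMr//; apply: le_trans bq; lra.
set y := (_ *m _) 0 0 in yr *; set u := b / 2 * _.
by move=> ur; have := ler_distD y u 0; rewrite !subr0 (distrC u); lra.
Qed.

(** * Constants and conclusion *)

Lemma real_bounds (R : realType) (f : R -> R) (D : set R) :
  (0 < ereal_inf [set (f w)%:E | w in D])%E ->
  (ereal_sup [set (f w)%:E | w in D] < +oo)%E ->
  exists m M : R, 0 < m /\ forall w, D w -> m <= f w <= M.
Proof.
move=> inf0 supy.
have [m m0 mf] : exists2 m : R, 0 < m & forall w, D w -> m <= f w.
  have lb w : D w -> (ereal_inf [set (f w)%:E | w in D] <= (f w)%:E)%E.
    by move=> Dw; apply: ereal_inf_lbound; exists w.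
  case: ereal_inf inf0 lb => [m||]//.
  - by rewrite lte_fin => m0 mf; exists m => // w /mf; rewrite lee_fin.
  - by move=> _ fy; exists 1 => // w /fy.
have [M fM] : exists M : R, forall w, D w -> f w <= M.
  have ub w : D w -> ((f w)%:E <= ereal_sup [set (f w)%:E | w in D])%E.
    by move=> Dw; apply: ereal_sup_ubound; exists w.
  case: ereal_sup supy ub => [M||]//.
  - by move=> _ fM; exists M => w /fM; rewrite lee_fin.
  - by move=> _ fy; exists 0 => w /fy.
by exists m, M; split => // w Dw; rewrite mf// fM.
Qed.

(** The threshold is of the order of [ln L]: [1 + 8 L <= L ^ 2] and [1 <= ln L]. *)
Lemma ln_threshold_le (R : realType) (L : R) : 9 <= L ->
  28 ^+ 2 + 128 * ln (1 + 8 * L) <= 1040 * ln L.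
Proof.
move=> L9; have L0 : 0 < L by lra.
have l1 : 1 <= ln L.
  have e2 : expR 2^-1 <= 2 :> R.
    rewrite -lef_pV2 ?posrE ?expR_gt0// -expRN.
    by have := expR_ge1Dx (- 2^-1 : R); lra.
  have e1 : expR 1 = expR 2^-1 * expR 2^-1 :> R.
    by rewrite -expRD; congr expR; lra.
  rewrite -[leLHS]expRK ler_ln ?posrE ?expR_gt0//; apply: le_trans L9.
  by rewrite e1; have := expR_gt0 (2^-1 : R); nra.
have l2 : ln (1 + 8 * L) <= 2 * ln L.
  have -> : 2 * ln L = ln (L * L) by rewrite lnM ?posrE// mulr_natl.
  rewrite ler_ln ?posrE//; nra.
by rewrite expr2; lra.
Qed.

(** The factor 8 makes each tail at most [2 / (8 L)], so that the [beta + 2] tails have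
total mass at most [delta (beta + 2) / (4 beta)]. *)
Lemma error_budget_le (R : realType) (beta delta L N : R) : 0 < delta -> 1 <= beta ->
  L = beta / delta -> N <= beta + 1 ->
  (N + 1) * (2 * expR (- ((28 ^+ 2 + 128 * ln (1 + 8 * L)) / 128))) <= delta.
Proof.
move=> d0 b1 LE N1; have L0 : 0 < L by rewrite LE divr_gt0//; lra.
have p0 : 0 < 1 + 8 * L by lra.
have E8 : expR (- ((28 ^+ 2 + 128 * ln (1 + 8 * L)) / 128)) <= (8 * L)^-1.
  apply: (@le_trans _ _ (expR (- ln (1 + 8 * L)))).
    by rewrite ler_expR; lra.
  rewrite expRN lnK ?posrE// lef_pV2 ?posrE//; lra.
set E := expR _ in E8 *.
apply: (@le_trans _ _ ((beta + 2) * (2 * (8 * L)^-1))).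
  have E0 : 0 < E := expR_gt0 _.
  apply: (@le_trans _ _ ((beta + 2) * (2 * E))).
    by rewrite ler_pM2r; lra.
  by rewrite ler_pM2l; lra.
have -> : (beta + 2) * (2 * (8 * L)^-1) = delta * ((beta + 2) / (4 * beta)).
  by rewrite LE; field; rewrite !gt_eqF//; lra.
rewrite -[leRHS]mulr1 ler_pM2l// ler_pdivrMr; lra.
Qed.

Theorem theorem3p3 (R : realType) (c lambda : R) (hc : 0 < c)
    (hlambda : 0 < lambda) :
  exists C : R, 0 < C /\
  forall alpha : R, 0 < alpha < 2^-1 ->
  exists threshold : nat -> R -> R,
  forall delta : R, 0 < delta < 1 ->
  (forall n : nat, 0 < threshold n delta) /\
  forall f : R -> R,
  (forall w, w \in `[- pi, pi] -> f (- w) = f w) ->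
  (forall w, w \in `[- pi, pi] ->
     (fun N : nat => fourier_sum f N w) @ \oo --> f w) ->
  fourier_coef f 0 = 1 ->
  (0 < ereal_inf [set (f w)%:E | w in `[(- pi)%R, pi%R]])%E ->
  (ereal_sup [set (f w)%:E | w in `[(- pi)%R, pi%R]] < +oo)%E ->
  (forall k : nat,
     `|fourier_coef f k%:Z| <= c * (1 + k%:R) `^ (- (1 + lambda))) ->
  exists n0 : nat, forall n : nat, (n0 <= n)%N ->
  forall b : R, b != 0 ->
  `|b| >= C * Num.sqrt (f 0 * n%:R^-1 * ln (n%:R * (1 - 2 * alpha) / delta)) ->
  forall (d : measure_display) (Omega : measurableType d)
    (X : 'I_n -> {mfun Omega >-> R})
    (P0 : probability Omega R) (P1 : nat -> probability Omega R),
  gaussian_with P0 X 0 (toeplitz n f) ->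
  (forall t : nat, change_point alpha n t ->
     gaussian_with (P1 t) X ((b / 2) *: zeta R n t) (toeplitz n f)) ->
  (detection_error alpha X P0 P1
     (glrt alpha (toeplitz n f) (threshold n delta)) <= delta%:E)%E.
Proof.
(* Since [q_t >= n / (4 f 0)] and the threshold is at most [1040 * ln L], a constant
   [C] with [C ^ 2 / 4 >= 16 * 1040] suffices. *)
exists 300; split => [|alpha a01]; first by rewrite ltr0n.
have /andP[a0 a2] := a01.
(* The term [28 ^+ 2] makes the radius at least 28, as the tail bound requires. *)
exists (fun n delta =>
  28 ^+ 2 + 128 * ln (1 + 8 * (n%:R * (1 - 2 * alpha) / delta))).
move=> delta /andP[d0 d1].
have b0 : 0 < 1 - 2 * alpha by lra.
have lnge0 (n : nat) : 0 <= ln (1 + 8 * (n%:R * (1 - 2 * alpha) / delta)).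
  by apply: ln_ge0; rewrite lerDl mulr_ge0// divr_ge0 ?mulr_ge0 ?(ltW d0) ?(ltW b0).
split=> [n|f _ fS _ finf fsup _]; first by have := lnge0 n; lra.
have [m [M [m0 fmM]]] := real_bounds finf fsup.
have mf := measurable_fourier_limit fS.
have I0 : (0 : R) \in `[- pi, pi].
  by rewrite in_itv/= oppr_le0 pi_ge0.
have f0 : 0 < f 0 by have /andP[/(lt_le_trans m0)] := fmM 0 I0.
have [k0 sec] := toeplitz_sum_le f0 (fS _ I0).
(* From this rank on, [alpha n >= k0] makes both segments long, and
   [n (1 - 2 alpha) >= 9] makes the logarithm at least 1. *)
exists (maxn (Num.truncn (k0%:R / alpha)).+1
             (Num.truncn (9 / (1 - 2 * alpha))).+1) => n.
rewrite geq_max => /andP[n1 n2] b bn0 bC d Omega X P0 P1 g0 g1.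
have k0n : k0%:R <= alpha * n%:R.
  rewrite mulrC -ler_pdivrMr//; apply: le_trans (ltW (truncnS_gt _)) _.
  by rewrite ler_nat.
have n9 : 9 <= n%:R * (1 - 2 * alpha).
  rewrite -ler_pdivrMr//; apply: le_trans (ltW (truncnS_gt _)) _.
  by rewrite ler_nat.
have nR : 0 < n%:R :> R by rewrite ltr0n; case: (n) n1.
set L := n%:R * (1 - 2 * alpha) / delta in bC *.
have L9 : 9 <= L.
  rewrite ler_pdivlMr//; apply: le_trans n9; nra.
set thr := 28 ^+ 2 + _.
have thr28 : 28 ^+ 2 <= thr by rewrite lerDl mulr_ge0//; exact: (lnge0 n).
have thr0 : 0 <= thr by lra.
have -> : thr = Num.sqrt thr ^+ 2 by rewrite sqr_sqrtr.
apply: le_trans (detection_error_le (b := b) _ _ _ g0 g1) _.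
- exact: toeplitz_positive_definite mf fmM m0.
- by rewrite -[leLHS]ger0_norm// -sqrtr_sqr ler_sqrt.
- move=> t pt; have [tn at0 ant] := change_point_bounds a0 pt.
  have kt : (k0 <= t)%N by rewrite -(ler_nat R); lra.
  have knt : (k0 <= n - t)%N by rewrite -(ler_nat R); lra.
  have [nq q0] := zeta_inverse_form_ge mf fmM m0 sec kt knt tn.
  split => //; rewrite sqr_sqrtr//.
  have lnL0 : 0 <= ln L by apply: ln_ge0; lra.
  have B2 : 300 ^+ 2 * (f 0 * n%:R^-1 * ln L) <= b ^+ 2.
    have x0 : 0 <= f 0 * n%:R^-1 * ln L.
      by rewrite mulr_ge0// mulr_ge0 ?invr_ge0// ltW.
    rewrite -(real_normK (num_real b)) -[X in _ * X](sqr_sqrtr x0).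
    by rewrite -exprMn ler_pXn2r ?nnegrE ?normr_ge0 ?mulr_ge0 ?ler0n ?sqrtr_ge0.
  have F4 : 4^-1 <= f 0 * n%:R^-1 * quad_form (invmx (toeplitz n f)) (zeta R n t).
    by rewrite mulrAC ler_pdivlMr//; lra.
  have := ler_wpM2r (ltW q0) B2; have := ler_wpM2r lnL0 F4.
  by have := ln_threshold_le L9; rewrite -/thr; lra.
rewrite lee_fin sqr_sqrtr//; apply: (error_budget_le d0 _ erefl).
  by lra.
exact: change_point_count.
Qed.
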